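(* Let $N \ge 1$ and let a deep network with $N$ stages and parameter vector $\boldsymbol{\theta}$ ranging over a parameter space $\Theta$ be given by $\boldsymbol{z}_0 = \boldsymbol{x}$, $\boldsymbol{z}_i = \boldsymbol{f}_i(\boldsymbol{z}_{i-1})$ for $i = 1, \dots, N$, where $\boldsymbol{x}$ is the input, $\boldsymbol{f}_i$ (depending on $\boldsymbol{\theta}$) is the $i$-th stage, and $\boldsymbol{z}_N = \boldsymbol{y}$ is the output. For $1 \le i \le N$ let $\Theta_i \subseteq \Theta$ be the set of all parameters $\boldsymbol{\theta}$ that cause the collapse of $\boldsymbol{z}_i$. Then for all $l, m$ with $1 \le l \le m \le N$, $$\Theta_l \subseteq \Theta_m.$$
   Context: For each parameter vector $\boldsymbol{\theta} \in \Theta$, every stage $\boldsymbol{f}_i = \boldsymbol{f}_i(\,\cdot\,;\boldsymbol{\theta})$ is a deterministic function from the space in which $\boldsymbol{z}_{i-1}$ takes values to the space in which $\boldsymbol{z}_i$ takes values. Thus, for fixed $\boldsymbol{\theta}$, each representation $\boldsymbol{z}_i = (\boldsymbol{f}_i \circ \boldsymbol{f}_{i-1} \circ \cdots \circ \boldsymbol{f}_1)(\boldsymbol{x})$ is a function of the input $\boldsymbol{x}$. The representation $\boldsymbol{z}_i$ is said to collapse at $\boldsymbol{\theta}$ if it is a constant function of the input, i.e. every input $\boldsymbol{x}$ is mapped to the same vector $\boldsymbol{z}_i$ (complete collapse). Hence $\Theta_i = \{\boldsymbol{\theta} \in \Theta \mid \boldsymbol{z}_i = \text{const.}\}$. *)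

(* Defs.v *)
From mathcomp Require Import all_boot.
From mathcomp Require Import classical_sets.

Set Implicit Arguments.
Unset Strict Implicit.
Unset Printing Implicit Defensive.

(* [space i] is the space in which z_i takes values; [space 0] is the input
   space and [space N] the output space.  Only the values at 0, ..., N matter.
   Stages are numbered from 0: for [i : 'I_N], [stage i theta] is the stage
   usually written f_(i+1)( . ; theta), which maps z_i to z_(i+1). *)
Record deepNetwork (N : nat) (Theta : Type) := DeepNetwork {
  space : nat -> Type;
  stage : forall i : 'I_N, Theta -> space i -> space i.+1
}.

Arguments stage {N Theta} _ _ _ _.

Section Collapse.
Variables (N : nat) (Theta : Type) (net : deepNetwork N Theta).

(* The recursive case typechecks because [i < N] is [i.+1 <= N], so its proof
   also makes [i] the index of a stage. *)
Fixpoint representation_rec (theta : Theta) (i : nat) :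
    (i <= N)%N -> space net 0 -> space net i :=
  match i with
  | 0 => fun _ x => x
  | j.+1 => fun ltjN x =>
      stage net (Ordinal ltjN) theta (representation_rec theta (ltnW ltjN) x)
  end.

Definition representation (theta : Theta) (i : 'I_N.+1) :
    space net 0 -> space net i :=
  representation_rec theta (ltnSE (ltn_ord i)).

Definition collapses (theta : Theta) (i : 'I_N.+1) : Prop :=
  exists c : space net i, forall x : space net 0, representation theta i x = c.

Definition collapse_set (i : 'I_N.+1) : set Theta :=
  [set theta | collapses theta i]%classic.

End Collapse.

(* Main.v *)
Require Import Defs.
From mathcomp Require Import all_boot.
From mathcomp Require Import classical_sets.

(** Each later representation is a function of the preceding one, and a function of a constant is
    constant. So collapse, once it occurs at stage [i], persists by induction on [j] starting from
    [i]. *)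

Lemma representation_rec_const_le (N : nat) (Theta : Type)
    (net : deepNetwork N Theta) (theta : Theta) (i j : nat)
    (hi : (i <= N)%N) (hj : (j <= N)%N) :
  (i <= j)%N ->
  (exists c, forall x, representation_rec (net := net) theta hi x = c) ->
  exists c, forall x, representation_rec (net := net) theta hj x = c.
Proof.
move=> leij consti.
(* The two representations lie in different types until [i = k] is eliminated; what then differs is
   only the proof of the bound. *)
have const_eq k (hk : (k <= N)%N) : i = k ->
    exists c, forall x, representation_rec (net := net) theta hk x = c.
  by move=> eik; case: k / eik hk => hk; rewrite (bool_irrelevance hk hi).
elim: j hj leij => [|j IHj] hj.
  by rewrite leqn0 => /eqP; apply: const_eq.
rewrite leq_eqVlt => /predU1P[|ltij]; first exact: const_eq.
(* [i < j.+1] is [i <= j] by conversion, and [ltnW hj] is the very proof used in the recursion, so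
   [constj] rewrites directly. The new constant is the image of [c] under the last stage. *)
have [c constj] := IHj (ltnW hj) ltij.
by exists (stage net (Ordinal hj) theta c) => x /=; rewrite constj.
Qed.

Theorem theorem1 (N : nat) (hN : (1 <= N)%N) (Theta : Type)
    (net : deepNetwork N Theta) (l m : 'I_N.+1)
    (hl : (1 <= l)%N) (hlm : (l <= m)%N) :
  (collapse_set net l `<=` collapse_set net m)%classic.
Proof. by move=> theta; apply: representation_rec_const_le. Qed.
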